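(* Let $n\ge 1$ and let $\mathbf{R}=R_1\times R_2\times\cdots\times R_n$, where each $R_i$ ($1\le i\le n$) is a commutative ring with unity with $\chi(R_i)<\infty$. For each $i$, let $\mathcal{A}_i$ be a maximum clique of $R_i$ chosen so that the number of its elements with square zero is as large as possible among all maximum cliques of $R_i$, and put $\mathcal{B}_i=\{x\in\mathcal{A}_i : x^2=0\}$ and $\mathcal{C}_i=\{x\in\mathcal{A}_i : x^2\neq 0\}$. Then $$\omega(\mathbf{R})=\prod_{i=1}^{n}\bigl(\omega(R_i)-|\mathcal{C}_i|\bigr)+\sum_{i=1}^{n}\bigl(\omega(R_i)-|\mathcal{B}_i|\bigr).$$
   Context: All rings are commutative with unity (not necessarily finite). A ring $R$ is regarded as a simple graph whose vertices are all elements of $R$ (including $0$), two distinct vertices $x,y$ being adjacent if and only if $xy=0$. The chromatic number $\chi(R)$ is the minimum number of colors needed to color the elements of $R$ so that adjacent elements receive distinct colors. A clique of $R$ is a subset $A\subseteq R$ that induces a complete subgraph, i.e. $xy=0$ for all distinct $x,y\in A$. The clique number $\omega(R)$ is the maximum size of a clique of $R$, and a maximum clique is a clique $A$ with $|A|=\omega(R)$. Always $\omega(R)\le\chi(R)$. *)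

(* Defs.v *)
From HB Require Import structures.
From mathcomp Require Import all_boot all_order all_algebra.
From mathcomp Require Import finmap.
From mathcomp Require Import boolp classical_sets.

Set Implicit Arguments.
Unset Strict Implicit.
Unset Printing Implicit Defensive.

Import GRing.Theory.
Local Open Scope ring_scope.

(* A simple graph on a possibly infinite vertex type T is given by its
   adjacency relation e : rel T. *)
Section Graphs.
Variables (T : choiceType) (e : rel T).

Definition colorable (k : nat) : Prop :=
  exists c : T -> 'I_k, forall x y, e x y -> c x <> c y.

(* The value None stands for infinity: no finite proper coloring exists. *)
Definition chromatic_number : option nat :=
  xget None
    [set o | exists2 k : nat, o = Some k &
       colorable k /\ forall l, colorable l -> (k <= l)%N].

(* Cliques are finite sets. An infinite clique has finite subcliques of every
   size, so this does not affect the existence of a maximum. *)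
Definition clique (A : {fset T}) : Prop :=
  forall x y, x \in A -> y \in A -> x != y -> e x y.

Definition is_clique_number (k : nat) : Prop :=
  (exists2 A, clique A & #|` A|%fset = k) /\
  (forall A, clique A -> (#|` A|%fset <= k)%N).

(* The default value 0 is taken exactly when the graph is empty or the sizes
   of its cliques are unbounded; see clique_number_gt0. *)
Definition clique_number : nat := xget 0%N [set k | is_clique_number k].

Definition maximum_clique (A : {fset T}) : Prop :=
  clique A /\ #|` A|%fset = clique_number.

Lemma clique_numberP (n : nat) :
  (forall A, clique A -> (#|` A|%fset <= n)%N) ->
  is_clique_number clique_number.
Proof.
move=> bnd; suff : exists k, is_clique_number k by exact: xgetPex.
pose P k := `[< exists2 A, clique A & #|` A|%fset = k >].
have exP : exists k, P k.
  exists 0%N; apply/asboolP; exists fset0; last exact: cardfs0.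
  by move=> x y; rewrite in_fset0.
have ubP k : P k -> (k <= n)%N by move/asboolP=> [A /bnd + <-].
case: (ex_maxnP exP ubP) => k /asboolP kP kmax; exists k; split=> // A cA.
by apply: kmax; apply/asboolP; exists A.
Qed.

Lemma clique_number_gt0 (x0 : T) :
  (0 < clique_number)%N <->
  exists n : nat, forall A, clique A -> (#|` A|%fset <= n)%N.
Proof.
split=> [|[n /clique_numberP [_ w_ub]]].
  rewrite /clique_number; case: xgetP => //= k _ [_ k_ub] _.
  by exists k.
rewrite -(cardfs1 x0); apply: w_ub => x y.
by rewrite !in_fset1 => /eqP-> /eqP->; rewrite eqxx.
Qed.

End Graphs.

Definition zero_prod_graph (R : pzRingType) : rel R :=
  [rel x y | (x != y) && (x * y == 0)].

Definition chi (R : comPzRingType) : option nat :=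
  chromatic_number (@zero_prod_graph R).

Definition omega (R : comPzRingType) : nat :=
  clique_number (@zero_prod_graph R).

Section SquareZero.
Variable R : comPzRingType.
Implicit Type A : {fset R}.

Definition sq_zero_part A : {fset R} := [fset x in A | x ^+ 2 == 0]%fset.
Definition sq_nonzero_part A : {fset R} := [fset x in A | x ^+ 2 != 0]%fset.

Definition ring_maximum_clique A : Prop :=
  maximum_clique (@zero_prod_graph R) A.

Definition optimal_maximum_clique A : Prop :=
  ring_maximum_clique A /\
  forall A', ring_maximum_clique A' ->
    (#|` sq_zero_part A'| <= #|` sq_zero_part A|)%fset%N.

End SquareZero.

(* The direct product of a finite family of rings, with componentwise
   operations; the library only has the case of a constant family. *)
Section RingProduct.
Variables (I : finType) (R : I -> comPzRingType).

Definition ring_product : Type := {dffun forall i, R i}.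
HB.instance Definition _ := Choice.on ring_product.

Implicit Types f g h : ring_product.

Definition rp_zero : ring_product := [ffun i => 0 : R i].
Definition rp_one : ring_product := [ffun i => 1 : R i].
Definition rp_opp f : ring_product := [ffun i => - f i : R i].
Definition rp_add f g : ring_product := [ffun i => f i + g i : R i].
Definition rp_mul f g : ring_product := [ffun i => f i * g i : R i].

Fact rp_addA : associative rp_add.
Proof. by move=> f g h; apply/ffunP=> i; rewrite !ffunE addrA. Qed.
Fact rp_addC : commutative rp_add.
Proof. by move=> f g; apply/ffunP=> i; rewrite !ffunE addrC. Qed.
Fact rp_add0 : left_id rp_zero rp_add.
Proof. by move=> f; apply/ffunP=> i; rewrite !ffunE add0r. Qed.
Fact rp_addN : left_inverse rp_zero rp_opp rp_add.
Proof. by move=> f; apply/ffunP=> i; rewrite !ffunE addNr. Qed.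

HB.instance Definition _ :=
  GRing.isZmodule.Build ring_product rp_addA rp_addC rp_add0 rp_addN.

Fact rp_mulA : associative rp_mul.
Proof. by move=> f g h; apply/ffunP=> i; rewrite !ffunE mulrA. Qed.
Fact rp_mulC : commutative rp_mul.
Proof. by move=> f g; apply/ffunP=> i; rewrite !ffunE mulrC. Qed.
Fact rp_mul1 : left_id rp_one rp_mul.
Proof. by move=> f; apply/ffunP=> i; rewrite !ffunE mul1r. Qed.
Fact rp_mulDl : left_distributive rp_mul rp_add.
Proof. by move=> f g h; apply/ffunP=> i; rewrite !ffunE mulrDl. Qed.

HB.instance Definition _ :=
  GRing.Zmodule_isComPzRing.Build ring_product
    rp_mulA rp_mulC rp_mul1 rp_mulDl.

End RingProduct.

(* Main.v *)
Require Import Defs.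
From mathcomp Require Import all_boot all_order all_algebra.
From mathcomp Require Import finmap zify.
From mathcomp Require boolp.

Set Implicit Arguments.
Unset Strict Implicit.
Unset Printing Implicit Defensive.

Import GRing.Theory.
Local Open Scope fset_scope.
Local Open Scope ring_scope.

(** In a clique of a ring split the vertices into those of square zero, a set
    [N] with [x * y = 0] for all [x], [y] in it (equal or not), and the others,
    a set [E] of pairwise orthogonal elements that also annihilate [N].  Write
    [(B i, C i)] for this splitting of the chosen clique of [R i]; the claim is
    that the product has clique number [\prod_i #|B i| + \sum_i #|C i|].

    The tuples with all components in the [B i], together with the elements of
    the [C i] placed on the coordinate axes, form a clique of that size.
    Conversely, let [(N, E)] be a split clique of the product.  The [i]-th
    components of [N] with [0] added, [n i], and those of [E] whose square is
    nonzero, [t i], form a split clique of [R i].  Orthogonality makes the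
    projection to [t i] injective, so [#|N| <= \prod_i #|n i|] and
    [#|E| <= \sum_i #|t i|], while [#|n i| + #|t i| <= #|B i| + #|C i|].
    Provided that [#|n i| <= #|B i|], the product gains at least
    [\sum_i (#|B i| - #|n i|)] when each [n i] grows to [B i], which pays for
    whatever the [t i] have in excess of the [C i].

    The remaining inequality is the heart of the proof ([null_set_leq]): the
    set [B] of the square-zero elements of an optimal maximum clique [B + C] is
    as large as any set [J] with [J * J = 0].  It rests on an exchange principle
    ([exchange]): if [x * x = 0], [x] annihilates [B], and [x] annihilates all
    of [C] except for a part [S] with at most [#|B|] elements, then [x] is in
    [B], because otherwise [B], [x + B] and the rest of [C] would form a better
    clique.  In particular the sums [x] over parts [S] of [C] show that the
    squares of the elements of [C] have no short zero sum ([zero_sum_free]).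

    Let [J] be of maximum size and suppose [#|B| < #|J|]; both are additive
    groups, and [K], the annihilator of [J] in [B], lies in both, so that
    [#|B| + #|K| <= #|J|] by divisibility.  The exchange principle gives
    [c * J <= B], hence [c ^+ 2 * J = 0], for [c] in [C].  If [c ^+ 4 != 0],
    then [c] may be replaced by [c ^+ 2], which annihilates [J]; otherwise
    [c ^+ 2] is in [K].  Hence the elements of [C] that cannot be kept next to
    [J] have their squares in [K].  There are at most [#|K|] of them, since any
    [#|K|] elements of a group of order [#|K|] have a nonempty zero-sum
    subsequence.  So [J] with the rest of [C] is at least as large as the
    optimal clique and has more elements of square zero, a contradiction. *)

(** * Cliques and colorings *)

Section CliqueNumber.
Variables (T : choiceType) (e : rel T).

Lemma clique_number_eq w : is_clique_number e w -> clique_number e = w.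
Proof.
move=> [[A cA cardA] maxA].
have [[A' cA' <-] maxA'] := clique_numberP maxA.
by apply/eqP; rewrite eqn_leq maxA //= -cardA maxA'.
Qed.

Lemma colorable_clique_leq k A :
  colorable e k -> clique e A -> (#|` A| <= k)%N.
Proof.
move=> [c c_proper] cA.
have c_inj : injective (fun a : A => c (val a)).
  move=> a b eq_c; apply/eqP; apply: contraPT eq_c => neq_ab.
  by apply: c_proper; apply: cA (valP a) (valP b) _; rewrite (inj_eq val_inj).
by rewrite cardfE -[k]card_ord; apply: leq_card c_inj.
Qed.

Lemma finite_chromatic_clique_number :
  chromatic_number e <> None -> exists w, is_clique_number e w.
Proof.
rewrite /chromatic_number; case: classical_sets.xgetP => //= _ _ [k _ [ck _]] _.
by exists (clique_number e); apply: (@clique_numberP _ _ k) => A;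
  apply: colorable_clique_leq.
Qed.

End CliqueNumber.

(** * Finite additive subgroups *)

Section AdditiveCombinatorics.
Variable V : zmodType.
Implicit Types K X : {fset V}.

Definition fset_subgroup K :=
  0 \in K /\ forall x y, x \in K -> y \in K -> x - y \in K.

Lemma fset_subgroupD K x y :
  fset_subgroup K -> x \in K -> y \in K -> x + y \in K.
Proof.
move=> [K0 KB] Kx Ky; rewrite -[y]opprK; apply: (KB) => //.
by rewrite -[- y]add0r; apply: KB.
Qed.

(** Lagrange's theorem for a finite subgroup of a possibly infinite group: [X]
    is a disjoint union of cosets of [K], removed here one at a time. *)
Lemma dvdn_card_coset_closed K X : fset_subgroup K ->
  (forall x k, x \in X -> k \in K -> x + k \in X) -> (#|` K| %| #|` X|)%N.
Proof.
move=> gK; have [K0 KB] := gK.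
have [m] := ubnP #|` X|; elim: m X => // m IHm X leXm XK.
have [->|[x Xx]] := fset_0Vmem X; first by rewrite cardfs0 dvdn0.
pose Y := [fset x + k | k in K].
have YX : Y `<=` X by apply/fsubsetP=> _ /imfsetP[k /= Kk ->]; apply: XK.
have cardY : #|` Y| = #|` K| by apply: card_imfset => k l /addrI.
have Yx : x \in Y by apply/imfsetP; exists 0; rewrite ?addr0.
have K_gt0 : (0 < #|` K|)%N by rewrite cardfs_gt0; apply/fset0Pn; exists 0.
have cardX : #|` X `\` Y| = (#|` X| - #|` K|)%N by rewrite cardfsDS // cardY.
have leKX : (#|` K| <= #|` X|)%N by rewrite -cardY fsubset_leq_card.
rewrite -(subnK leKX) dvdn_addl // -cardX; apply: IHm.
  by rewrite cardX; lia.
move=> y k; rewrite !inE => /andP[nYy Xy] Kk; rewrite XK // andbT.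
apply: contra nYy => /imfsetP[l /= Kl def_yk].
apply/imfsetP; exists (l - k) => /=; first exact: KB.
by rewrite addrA -def_yk addrK.
Qed.

(** Two of the [#|K| + 1] initial segments of [s] of length at most [#|K|] have
    the same sum, and what lies between them sums to zero. *)
Lemma zero_sum_subseq K (T : eqType) (f : T -> V) (s : seq T) :
    fset_subgroup K -> (forall x, x \in s -> f x \in K) ->
    (#|` K| <= size s)%N ->
  exists t, [/\ subseq t s, t != [::], (size t <= #|` K|)%N
              & \sum_(x <- t) f x = 0].
Proof.
move=> gK fK leKs; have [K0 _] := gK.
have sumK t : {subset t <= s} -> \sum_(x <- t) f x \in K.
  move=> ts; rewrite big_seq; elim/big_ind: _ => //.
    by move=> *; apply: fset_subgroupD.
  by move=> x /ts /fK.
have prefK (i : 'I_(#|` K|.+1)) : \sum_(x <- take i s) f x \in K.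
  by apply: sumK; apply/mem_subseq/take_subseq.
pose g (i : 'I_(#|` K|.+1)) : K := [` prefK i].
have : ~~ injectiveb g.
  apply/negP=> /injectiveP /leq_card.
  by rewrite card_ord -cardfE ltnn.
case/injectivePn=> i [j neq_ij /(congr1 val) /= eq_ij].
wlog lt_ij : i j neq_ij eq_ij / (i < j)%N.
  move=> W; have [|le_ji] := ltnP i j; first exact: W.
  apply: (W j i) => //; first by rewrite eq_sym.
  by rewrite ltn_neqAle le_ji andbT eq_sym.
have le_js : (j <= size s)%N by apply: leq_trans leKs; rewrite -ltnS.
exists (drop i (take j s)); split.
- exact: subseq_trans (drop_subseq _ _) (take_subseq _ _).
- by rewrite -size_eq0 size_drop size_takel // subn_eq0 -ltnNge.
- by rewrite size_drop size_takel // (leq_trans (leq_subr _ _)) // -ltnS.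
- apply: (@addrI _ (\sum_(x <- take i s) f x)); rewrite addr0.
  have -> : take i s = take i (take j s) by rewrite take_takel // ltnW.
  rewrite -big_cat cat_take_drop -eq_ij.
  by rewrite take_takel // ltnW.
Qed.

End AdditiveCombinatorics.

(** * Splitting a clique by vanishing squares *)

Section SplitCliques.
Variable R : comPzRingType.
Implicit Types (A B C J K N E S : {fset R}) (x y : R).

Definition kills x N := forall y, y \in N -> x * y = 0.

(** The case of equal factors is included: every element has square zero. *)
Definition null_set N := forall x, x \in N -> kills x N.

Definition split_clique N E :=
  [/\ null_set N,
      forall x, x \in E -> x ^+ 2 != 0,
      forall x y, x \in E -> y \in E -> x != y -> x * y = 0
    & forall x, x \in E -> kills x N].

(** Optimality of a maximum clique, in terms of the sizes of the two parts only:
    no split clique is larger, and none of the same size has a larger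
    square-zero part. *)
Definition optimal_split B C := split_clique B C /\
  forall N E, split_clique N E ->
    (#|` N| + #|` E| <= #|` B| + #|` C|)%N /\
    ((#|` B| + #|` C| <= #|` N| + #|` E|)%N -> (#|` N| <= #|` B|)%N).

Lemma ring_cliqueP A : clique (@zero_prod_graph R) A <->
  forall x y, x \in A -> y \in A -> x != y -> x * y = 0.
Proof.
split=> cA x y Ax Ay neq_xy; first by have /andP[_ /eqP] := cA x y Ax Ay neq_xy.
by rewrite /zero_prod_graph /= neq_xy cA ?eqxx.
Qed.

Lemma card_sq_parts A :
  (#|` sq_zero_part A| + #|` sq_nonzero_part A| = #|` A|)%N.
Proof.
rewrite -(cardfsID (sq_zero_part A) A); congr (_ + _)%N; congr #|` _|.
  by apply/fsetP=> x; rewrite !inE; case: (x \in A).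
by apply/fsetP=> x; rewrite !inE; case: (x \in A); rewrite ?andbF ?andbT.
Qed.

Lemma clique_split A : clique (@zero_prod_graph R) A ->
  split_clique (sq_zero_part A) (sq_nonzero_part A).
Proof.
move=> /ring_cliqueP cA; split=> [x|x|x y|x].
- rewrite !inE => /andP[Ax /eqP x2] y; rewrite !inE => /andP[Ay _].
  by have [<-|/cA->] := eqVneq x y; rewrite -?expr2.
- by rewrite !inE => /andP[].
- by rewrite !inE => /andP[Ax _] /andP[Ay _]; apply: cA.
- rewrite !inE => /andP[Ax x2] y; rewrite !inE => /andP[Ay y2].
  by apply: cA => //; apply: contraNneq x2 => ->.
Qed.

Lemma split_clique_union N E : split_clique N E ->
  [/\ clique (@zero_prod_graph R) (N `|` E), sq_zero_part (N `|` E) = N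
    & #|` N `|` E| = (#|` N| + #|` E|)%N].
Proof.
move=> [N0 E2 EE EN].
have sqE x : (x \in N `|` E) && (x ^+ 2 == 0) = (x \in N).
  rewrite inE; have [Nx|_] /= := boolP (x \in N).
    by rewrite expr2 N0 ?eqxx.
  by apply/andP=> -[/E2/negP].
split; last 1 first.
- rewrite cardfsU (_ : N `&` E = fset0) ?cardfs0 ?subn0 //.
  apply/fsetP=> x; rewrite !inE; apply/andP=> -[Nx /E2/eqP[]].
  by rewrite expr2 N0.
- apply/ring_cliqueP=> x y; rewrite !inE.
  case/orP=> [Nx|Ex] /orP[Ny|Ey] neq_xy; [exact: N0 | | exact: EN | exact: EE].
  by rewrite mulrC EN.
- by apply/fsetP=> x; rewrite -sqE !inE.
Qed.

(** A finite clique number is assumed because otherwise [omega R] is the default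
    value [0], and the empty set is the only maximum clique. *)
Lemma optimal_cliqueP A w : is_clique_number (@zero_prod_graph R) w ->
    optimal_maximum_clique A ->
  optimal_split (sq_zero_part A) (sq_nonzero_part A).
Proof.
move=> w_num [[cA cardA] maxA]; split=> [|N E]; first exact: clique_split.
move=> /split_clique_union[cNE zNE cardNE].
have [_ le_omega] : is_clique_number (@zero_prod_graph R) (omega R).
  by rewrite /omega /clique_number; case: classical_sets.xgetP => // /(_ w).
rewrite card_sq_parts -cardNE cardA; split=> [|ge]; first exact: le_omega.
rewrite -zNE; apply: maxA; split=> //.
by apply/eqP; rewrite eqn_leq ge le_omega.
Qed.

End SplitCliques.

(** * Square-zero elements of an optimal maximum clique *)

Section OptimalSplit.
Variables (R : comPzRingType) (B C : {fset R}).
Hypothesis optBC : optimal_split B C.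
Implicit Types (J K N E S : {fset R}) (x y : R).

Let B0 : null_set B. Proof. by have [[]] := optBC. Qed.
Let C2 x : x \in C -> x ^+ 2 != 0.
Proof. by have [[_ + _ _] _] := optBC; apply. Qed.
Let CC x y : x \in C -> y \in C -> x != y -> x * y = 0.
Proof. by have [[_ _ + _] _] := optBC; apply. Qed.
Let CB x : x \in C -> kills x B.
Proof. by have [[_ _ _ +] _] := optBC; apply. Qed.

Lemma optimal_split_saturated x :
  x ^+ 2 = 0 -> kills x B -> kills x C -> x \in B.
Proof.
move=> x2 xB xC; apply: contraT => nBx.
have [|] := (optBC.2 (x |` B) C); last by rewrite cardfsU1 nBx addSn ltnn.
split=> // [y|y Cy z]; rewrite !inE.
  move=> yB z; rewrite !inE; case/orP: yB => [/eqP->|By] /orP[/eqP->|Bz].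
  + by rewrite -expr2.
  + exact: xB.
  + by rewrite mulrC xB.
  + exact: B0.
by case/orP=> [/eqP->|Bz]; [rewrite mulrC xC | apply: CB].
Qed.

Lemma optimal_split_subgroup : fset_subgroup B.
Proof.
split=> [|x y Bx By].
  by apply: optimal_split_saturated => [|y _|y _]; rewrite ?expr0n ?mul0r.
apply: optimal_split_saturated => [|z Bz|z Cz].
- by rewrite expr2 mulrBl !mulrBr !B0 ?subrr.
- by rewrite mulrBl !B0 ?subrr.
- by rewrite mulrBl ![_ * z]mulrC !CB ?subrr.
Qed.

(** If [x] were not in [B], then [B] and its coset [x + B] together would be a
    null set with [2 * #|B|] elements, enough to make up for the loss of [S];
    the resulting clique would have too many elements of square zero. *)
Lemma exchange S x : S `<=` C -> (#|` S| <= #|` B|)%N ->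
  x ^+ 2 = 0 -> kills x B -> kills x (C `\` S) -> x \in B.
Proof.
move=> SC leSB x2 xB xC; apply: contraT => nBx.
have [_ BB] := optimal_split_subgroup.
pose B' := [fset x + b | b in B].
have dis : B `&` B' = fset0.
  apply/fsetP=> y; rewrite !inE; apply/andP=> -[By /imfsetP[b /= Bb def_y]].
  by case/negP: nBx; rewrite -(addrK b x) -def_y BB.
have cardB' : #|` B'| = #|` B| by apply: card_imfset => b b' /addrI.
have cardN : #|` B `|` B'| = (#|` B| + #|` B|)%N.
  by rewrite cardfsU dis cardfs0 subn0 cardB'.
have xN : kills x (B `|` B').
  move=> y /fsetUP[/xB//|/imfsetP[b /= Bb ->]].
  by rewrite mulrDr -expr2 x2 xB ?addr0.
have bN b : b \in B -> kills b (B `|` B').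
  move=> Bb y /fsetUP[By|/imfsetP[b' /= Bb' ->]]; first exact: B0.
  by rewrite mulrDr mulrC xB // add0r B0.
have [|_ le] := optBC.2 (B `|` B') (C `\` S).
  split=> [y|y|y z|y].
  - case/fsetUP=> [/bN//|/imfsetP[b /= Bb ->]] z Nz.
    by rewrite mulrDl xN // bN // addr0.
  - by rewrite !inE => /andP[_ /C2].
  - by rewrite !inE => /andP[_ Cy] /andP[_ Cz]; apply: CC.
  - move=> Ey z; have Cy : y \in C by move: Ey; rewrite inE => /andP[].
    case/fsetUP=> [|/imfsetP[b /= Bb ->]]; first exact: CB.
    by rewrite mulrDr [y * b]CB // addr0 mulrC xC.
have [B0in _] := optimal_split_subgroup.
have B_gt0 : (0 < #|` B|)%N by rewrite cardfs_gt0; apply/fset0Pn; exists 0.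
have leSC := fsubset_leq_card SC.
by move: le; rewrite cardN cardfsDS //; lia.
Qed.

Lemma exists_largest_null_set : exists2 J : {fset R}, null_set J &
  forall N, null_set N -> (#|` N| <= #|` J|)%N.
Proof.
pose P k := boolp.asbool (exists2 N : {fset R}, null_set N & #|` N| = k).
have exP : exists k, P k.
  exists #|` B|; apply/boolp.asboolP; exists B => //; exact: B0.
have ubP k : P k -> (k <= #|` B| + #|` C|)%N.
  move=> /boolp.asboolP[N N0 <-].
  have [|] := optBC.2 N fset0; last by rewrite cardfs0 addn0.
  by split=> // x; rewrite inE.
case: (ex_maxnP exP ubP) => k /boolp.asboolP[J J0 <-] maxJ.
by exists J => // N N0; apply/maxJ/boolp.asboolP; exists N.
Qed.

Lemma largest_null_set_saturated J x : null_set J ->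
    (forall N, null_set N -> (#|` N| <= #|` J|)%N) ->
  x ^+ 2 = 0 -> kills x J -> x \in J.
Proof.
move=> J0 maxJ x2 xJ; apply: contraT => nJx.
have /maxJ : null_set (x |` J); last by rewrite cardfsU1 nJx ltnn.
move=> y yJ z; rewrite !inE; case/fset1UP: yJ => [->|Jy] /orP[/eqP->|Jz].
- by rewrite -expr2.
- exact: xJ.
- by rewrite mulrC xJ.
- exact: J0.
Qed.

(** Exchange [c] for [c * j], which is annihilated by the rest of the clique. *)
Lemma mul_null_set_mem c J j : null_set J -> c \in C -> j \in J -> c * j \in B.
Proof.
move=> J0 Cc Jj; apply: (@exchange [fset c]).
- by rewrite fsub1set.
- rewrite cardfs1 cardfs_gt0; apply/fset0Pn; exists 0.
  by have [] := optimal_split_subgroup.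
- by rewrite exprMn [j ^+ 2]expr2 (J0 j) // mulr0.
- by move=> b Bb; rewrite mulrAC (CB Cc) // mul0r.
- move=> d; rewrite !inE => /andP[neq_dc Cd].
  by rewrite mulrAC [c * d]CC ?mul0r 1?eq_sym.
Qed.

(** Exchange [c] for its square. *)
Lemma sq_mem_null_part c : c \in C -> c ^+ 2 * c ^+ 2 = 0 -> c ^+ 2 \in B.
Proof.
move=> Cc c4; apply: (@exchange [fset c]).
- by rewrite fsub1set.
- rewrite cardfs1 cardfs_gt0; apply/fset0Pn; exists 0.
  by have [] := optimal_split_subgroup.
- by rewrite [LHS]expr2.
- by move=> b Bb; rewrite [c ^+ 2]expr2 -mulrA [c * b]CB // mulr0.
- move=> d; rewrite !inE => /andP[neq_dc Cd].
  by rewrite [c ^+ 2]expr2 -mulrA [c * d]CC ?mulr0 1?eq_sym.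
Qed.

(** The sum [x] of [t] satisfies [x * d = d ^+ 2] for [d] in [t], so its square
    is the given sum.  Exchanging [t] for [x] puts [x] into [B], whence
    [d ^+ 2 = x * d = 0], which is impossible in [C]. *)
Lemma zero_sum_free (t : seq R) : uniq t -> {subset t <= C} ->
  (size t <= #|` B|)%N -> \sum_(d <- t) d ^+ 2 = 0 -> t = [::].
Proof.
move=> Ut tC leB sum0; case: t => // d0 t' in Ut tC leB sum0 *.
set t := d0 :: t' in Ut tC leB sum0 *.
pose x := \sum_(d <- t) d.
have xd d : d \in t -> x * d = d ^+ 2.
  move=> td; rewrite /x mulr_suml (bigD1_seq d) //= -expr2.
  rewrite big_seq_cond big1 ?addr0 // => e /andP[te neq_ed].
  by rewrite CC // tC.
have xB : x \in B.
  apply: (@exchange [fset d | d in t]).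
  - by apply/fsubsetP=> d; rewrite !inE => /tC.
  - by apply: leq_trans leB; rewrite card_fseq undup_id.
  - rewrite expr2 {2}/x mulr_sumr; apply: etrans sum0.
    rewrite big_seq [RHS]big_seq.
    by apply: eq_bigr => d /xd.
  - move=> b Bb; rewrite /x mulr_suml big_seq big1 // => d /tC Cd.
    exact: CB.
  - move=> c; rewrite !inE => /andP[ntc Cc].
    rewrite /x mulr_suml big_seq big1 // => d td.
    by apply: CC; [exact: tC| |apply: contraNneq ntc => <-].
have td0 : d0 \in t by rewrite mem_head.
by have /eqP[] := C2 (tC _ td0); rewrite -xd // mulrC CB // tC.
Qed.

(** A larger null set [J], completed by those elements of [C], or their squares,
    that annihilate it, would be a clique contradicting the optimality of [B]
    and [C]; the elements of [C] that are lost have their squares in the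
    annihilator [K] of [J] in [B], and these squares have no short zero sum. *)
Lemma null_set_leq N : null_set N -> (#|` N| <= #|` B|)%N.
Proof.
have [J J0 maxJ] := exists_largest_null_set.
move=> N0; apply: leq_trans (maxJ _ N0) _.
rewrite leqNgt; apply/negP=> ltBJ.
have Jsat x : x ^+ 2 = 0 -> kills x J -> x \in J.
  exact: largest_null_set_saturated.
have [B_0 B_B] := optimal_split_subgroup.
have gJ : fset_subgroup J.
  split=> [|x y Jx Jy].
    by apply: Jsat => [|y _]; rewrite ?expr0n ?mul0r.
  apply: Jsat => [|z Jz]; first by rewrite expr2 mulrBl !mulrBr !J0 ?subrr.
  by rewrite mulrBl !J0 ?subrr.
pose killJ x := all (fun j => x * j == 0) J.
have killJP x : reflect (kills x J) (killJ x).
  by apply: (iffP allP) => H j Jj; [apply/eqP/H | rewrite H].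
pose K := [fset x in B | killJ x].
have KP x : (x \in K) = (x \in B) && killJ x by rewrite !inE.
have KJ x : x \in K -> x \in J.
  rewrite KP => /andP[Bx /killJP]; apply: Jsat.
  by rewrite expr2 (B0 Bx).
have gK : fset_subgroup K.
  split=> [|x y]; rewrite !KP.
    by rewrite B_0; apply/killJP => j _; rewrite mul0r.
  move=> /andP[Bx /killJP xJ] /andP[By /killJP yJ].
  rewrite B_B //; apply/killJP => j Jj.
  by rewrite mulrBl xJ // yJ // subrr.
have leBKJ : (#|` B| + #|` K| <= #|` J|)%N.
  have /dvdnP[b def_b] : (#|` K| %| #|` B|)%N.
    apply: dvdn_card_coset_closed gK _ => x k Bx; rewrite KP => /andP[Bk _].
    exact: fset_subgroupD optimal_split_subgroup _ _.
  have /dvdnP[j def_j] : (#|` K| %| #|` J|)%N.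
    by apply: dvdn_card_coset_closed gK _ => x k Jx /KJ; apply: fset_subgroupD.
  move: ltBJ; rewrite def_b def_j addnC -mulSn ltn_mul2r => /andP[_ ltbj].
  by rewrite leq_mul2r ltbj orbT.
(* The squares of the elements of C annihilate J, so they are the better
   choice unless their own squares vanish. *)
pose f (c : R) := if c ^+ 2 * c ^+ 2 == 0 then c else c ^+ 2.
have f2 c : c \in C -> f c ^+ 2 != 0.
  by rewrite /f => Cc; case: ifPn => [_|]; [exact: C2 | rewrite -expr2].
have fM c : exists y, f c = c * y.
  rewrite /f; case: ifP => _; first by exists 1; rewrite mulr1.
  by exists c; rewrite expr2.
have fC c d : c \in C -> d \in C -> c != d -> f c * f d = 0.
  move=> Cc Cd neq_cd; have [[y ->] [z ->]] := (fM c, fM d).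
  by rewrite mulrACA (CC Cc Cd) // mul0r.
have f_inj : {in C &, injective f}.
  move=> c d Cc Cd eq_f; apply: contraTeq (f2 c Cc) => neq_cd.
  by rewrite negbK expr2 {2}eq_f fC.
pose E := [fset c in C | killJ (f c)].
pose D := [fset c in C | ~~ killJ (f c)].
have cardC : (#|` E| + #|` D| = #|` C|)%N.
  rewrite -(cardfsID E C); congr (_ + _)%N; congr #|` _|.
    by apply/fsetP=> x; rewrite !inE; case: (x \in C).
  by apply/fsetP=> x; rewrite !inE; case: (x \in C); rewrite ?andbF ?andbT.
have EP c : c \in E -> c \in C /\ kills (f c) J.
  by rewrite !inE => /andP[Cc /killJP].
have splitJ : split_clique J (f @` E).
  split=> //.
  - by move=> _ /imfsetP[c /= /EP[Cc _] ->]; apply: f2.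
  - move=> x y /imfsetP[c /= /EP[Cc _] ->] /imfsetP[d /= /EP[Cd _] ->] neq.
    by apply: fC => //; apply: contraNneq neq => ->.
  - by move=> _ /imfsetP[c /= /EP[_ ?] ->].
have cardfE : #|` f @` E| = #|` E|.
  by apply: card_in_imfset => c d /EP[Cc _] /EP[Cd _]; apply: f_inj.
(* If few elements of C are lost, then J and f @` E contradict optimality. *)
have [|/ltnW leKD] := leqP #|` D| #|` K|.
  move=> leDK; have [_] := optBC.2 _ _ splitJ; rewrite cardfE; lia.
have DK d : d \in enum_fset D -> d ^+ 2 \in K.
  rewrite !inE => /andP[Cd].
  have d2J : kills (d ^+ 2) J.
    move=> j Jj; rewrite expr2 -mulrA CB //.
    exact: mul_null_set_mem Jj.
  rewrite /f; case: ifPn => [/eqP d4 _|_ /negP[]]; last exact/killJP.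
  by rewrite sq_mem_null_part //=; apply/killJP.
have [t [tD nt leKt sum0]] := zero_sum_subseq gK DK leKD.
case/eqP: nt; apply: zero_sum_free sum0.
- exact: subseq_uniq tD (fset_uniq D).
- by move=> d /(mem_subseq tD); rewrite !inE => /andP[].
- apply: leq_trans leKt (fsubset_leq_card _).
  by apply/fsubsetP=> x; rewrite KP => /andP[].
Qed.

End OptimalSplit.

(** * Counting lemmas for finite families *)

Section ProductBound.
Variable I : finType.

(** Since all factors are positive, raising one factor by [1] raises the product
    by at least [1]. *)
Lemma leq_prod_add_sum (a b : I -> nat) : (forall i, 0 < a i <= b i)%N ->
  (\prod_i a i + \sum_i (b i - a i) <= \prod_i b i)%N.
Proof.
move=> le_ab; suff: (0 < \prod_i a i)%N /\
    (\prod_i a i + \sum_i (b i - a i) <= \prod_i b i)%N by case.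
elim/big_rec3: _ => // i p s q _ [q_gt0 le_qs].
have /andP[ai_gt0 le_i] := le_ab i.
split; first by rewrite muln_gt0 ai_gt0.
rewrite -(subnK le_i); move: (b i - a i)%N => d; nia.
Qed.

Lemma card_imfset_fin (T : choiceType) (f : I -> T) : injective f ->
  #|` [fset f x | x : I]| = #|I|.
Proof. by move=> f_inj; rewrite card_imfset //= cardE. Qed.

Lemma leq_card_bigfcup (T : choiceType) (F : I -> {fset T}) :
  (#|` \big[fsetU/fset0]_i F i| <= \sum_i #|` F i|)%N.
Proof.
elim/big_rec2: _ => [|i m U _ leU]; first by rewrite cardfs0.
by rewrite cardfsU (leq_trans (leq_subr _ _)) // leq_add2l.
Qed.

End ProductBound.

(** * Cliques of a product of rings *)

Section ProductRing.
Variables (I : finType) (R : I -> comPzRingType).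
Implicit Types (x y : ring_product R) (N : forall i, {fset R i}).

Lemma rp_mulE x y i : (x * y) i = x i * y i. Proof. exact: ffunE. Qed.
Lemma rp_zeroE i : (0 : ring_product R) i = 0. Proof. exact: ffunE. Qed.

Lemma rp_eq0P x : (forall i, x i = 0) -> x = 0.
Proof. by move=> x0; apply/ffunP=> i; rewrite rp_zeroE. Qed.

Lemma rp_mul_eq0 x y i : x * y = 0 -> x i * y i = 0.
Proof. by rewrite -rp_mulE => ->; rewrite rp_zeroE. Qed.

Definition val_pi N (g : {dffun forall i, N i}) : ring_product R :=
  [ffun i => val (g i)].

Definition fset_pi N : {fset ring_product R} :=
  [fset val_pi g | g : {dffun forall i, N i}].

Lemma fset_piP N x : reflect (forall i, x i \in N i) (x \in fset_pi N).
Proof.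
apply: (iffP (imfsetP _ _ _ _)) => [[g _ ->] i|xN].
  by rewrite ffunE; apply: valP.
exists [ffun i => [` xN i]] => //.
by apply/ffunP=> i; rewrite !ffunE.
Qed.

Lemma card_fset_pi N : #|` fset_pi N| = (\prod_i #|` N i|)%N.
Proof.
rewrite card_imfset_fin => [|g h /ffunP eq_gh]; last first.
  by apply/ffunP=> i; apply: val_inj; have := eq_gh i; rewrite !ffunE.
rewrite card_dep_ffun foldrE big_map big_enum /=.
by apply: eq_bigr => i _; rewrite cardfE.
Qed.

Definition rp_inj i (a : R i) : ring_product R :=
  [ffun j => dfwith (fun k => 0 : R k) a j].

Lemma rp_injE i (a : R i) : rp_inj a i = a.
Proof. by rewrite ffunE dfwith_in. Qed.

Lemma rp_injN i j (a : R i) : i != j -> rp_inj a j = 0.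
Proof. by move=> neq_ij; rewrite ffunE dfwith_out. Qed.

Lemma rp_mul_inj_eq0 i (a : R i) x : a * x i = 0 -> rp_inj a * x = 0.
Proof.
move=> ax; apply: rp_eq0P => j; rewrite rp_mulE.
by have [<-|neq_ij] := eqVneq i j; rewrite ?rp_injE // rp_injN ?mul0r.
Qed.

Definition fset_axes N : {fset ring_product R} :=
  [fset rp_inj (val (tagged u)) | u : {i : I & N i}].

Lemma fset_axesP N x :
  x \in fset_axes N -> exists i (a : R i), a \in N i /\ x = rp_inj a.
Proof.
by case/imfsetP=> -[i a] _ -> /=; exists i, (val a); split; first exact: valP.
Qed.

Lemma card_fset_axes N : (forall i, 0 \notin N i) ->
  #|` fset_axes N| = (\sum_i #|` N i|)%N.
Proof.
move=> N0; rewrite card_imfset_fin => [|[i a] [j b] /= eq_ab].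
  rewrite card_tagged sumnE big_map big_enum /=.
  by apply: eq_bigr => i _; rewrite cardfE.
have [eq_ij|neq_ij] := eqVneq i j; last first.
  case/negP: (N0 i); rewrite -(rp_injN (val b) (i := j)) 1?eq_sym //.
  by rewrite -eq_ab rp_injE; apply: valP.
case: j / eq_ij b eq_ab => b /ffunP/(_ i); rewrite !rp_injE => /val_inj eq_ab.
by rewrite eq_ab.
Qed.

Variables B C : forall i, {fset R i}.
Hypothesis optBC : forall i, optimal_split (B i) (C i).

Lemma split_clique_product : split_clique (fset_pi B) (fset_axes C).
Proof.
have splitBC i : split_clique (B i) (C i) by case: (optBC i).
split.
- move=> x /fset_piP Bx y /fset_piP By; apply: rp_eq0P => i.
  by rewrite rp_mulE; have [B0 _ _ _] := splitBC i; apply: B0.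
- move=> _ /fset_axesP[i [a [Ca ->]]]; have [_ C2 _ _] := splitBC i.
  apply: contraNneq (C2 _ Ca) => /(@rp_mul_eq0 _ _ i).
  by rewrite rp_injE -expr2 => ->.
- move=> _ _ /fset_axesP[i [a [Ca ->]]] /fset_axesP[j [b [Cb ->]]] neq_ab.
  apply: rp_mul_inj_eq0.
  have [eq_ij|neq_ij] := eqVneq j i; last by rewrite rp_injN ?mulr0.
  case: i / eq_ij a Ca neq_ab => a Ca neq_ab; rewrite rp_injE.
  have [_ _ CC _] := splitBC j; apply: CC => //.
  by apply: contraNneq neq_ab => ->.
- move=> _ /fset_axesP[i [a [Ca ->]]] x /fset_piP Bx.
  by apply: rp_mul_inj_eq0; have [_ _ _ CB] := splitBC i; apply: CB.
Qed.

(** Each component of a split clique yields a split clique of the factor.  The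
    element [0] is added to its null part to make it nonempty, as the comparison
    of products requires. *)
Lemma split_clique_product_leq (N E : {fset ring_product R}) :
  split_clique N E ->
  (#|` N| + #|` E| <= \prod_i #|` B i| + \sum_i #|` C i|)%N.
Proof.
move=> [N0 E2 EE EN].
pose n i : {fset R i} := 0 |` [fset x i | x : ring_product R in N].
pose Ei i := [fset x in E | x i ^+ 2 != 0].
pose t i : {fset R i} := [fset x i | x : ring_product R in Ei i].
have nP i a : a \in n i -> a = 0 \/ exists2 x, x \in N & a = x i.
  by case/fset1UP=> [->|/imfsetP[x /= Nx ->]]; [left | right; exists x].
have tP i a : a \in t i ->
    exists x, [/\ x \in E, x i ^+ 2 != 0 & a = x i].
  by case/imfsetP=> x /=; rewrite !inE => /andP[Ex x2] ->; exists x.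
have split_nt i : split_clique (n i) (t i).
  split.
  - move=> a /nP[->|[x Nx ->]] b; first by rewrite mul0r.
    by case/nP=> [->|[y Ny ->]]; [rewrite mulr0 | apply/rp_mul_eq0/N0].
  - by move=> a /tP[x [_ x2 ->]].
  - move=> a b /tP[x [Ex _ ->]] /tP[y [Ey _ ->]] neq_xy.
    by apply/rp_mul_eq0/EE => //; apply: contraNneq neq_xy => ->.
  - move=> a /tP[x [Ex _ ->]] b.
    by case/nP=> [->|[y Ny ->]]; [rewrite mulr0 | apply/rp_mul_eq0/EN].
(* If x and y are distinct in E and x i = y i, then x i ^+ 2 = 0. *)
have card_t i : #|` t i| = #|` Ei i|.
  apply: card_in_imfset => x y; rewrite !inE => /andP[Ex x2] /andP[Ey _] eq_xy.
  apply: contraNeq x2 => neq_xy.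
  by rewrite expr2 {2}eq_xy (rp_mul_eq0 i (EE _ _ Ex Ey neq_xy)).
have leN : (#|` N| <= \prod_i #|` n i|)%N.
  rewrite -card_fset_pi; apply/fsubset_leq_card/fsubsetP=> x Nx.
  by apply/fset_piP=> i; apply/fset1UP; right; apply/imfsetP; exists x.
have leE : (#|` E| <= \sum_i #|` t i|)%N.
  rewrite (eq_bigr _ (fun i _ => card_t i)).
  apply: leq_trans (leq_card_bigfcup _); apply/fsubset_leq_card/fsubsetP=> x Ex.
  have [i x2] : exists i, x i ^+ 2 != 0.
    apply/existsP; apply: contraNT (E2 x Ex) => /existsPn x2.
    apply/eqP/rp_eq0P=> i; rewrite expr2 rp_mulE -expr2.
    exact/eqP/negPn/x2.
  by apply/bigfcupP; exists i; rewrite ?mem_index_enum // !inE Ex.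
have n_gt0 i : (0 < #|` n i|)%N.
  by rewrite cardfs_gt0; apply/fset0Pn; exists 0; rewrite fset1U1.
have le_nB i : (#|` n i| <= #|` B i|)%N.
  by have [n0 _ _ _] := split_nt i; apply: null_set_leq (optBC i) _ n0.
have le_nt i : (#|` t i| <= (#|` B i| - #|` n i|) + #|` C i|)%N.
  have [+ _] := (optBC i).2 _ _ (split_nt i); have := le_nB i; lia.
have le_prod : (\prod_i #|` n i| + \sum_i (#|` B i| - #|` n i|)
                 <= \prod_i #|` B i|)%N.
  by apply: leq_prod_add_sum => i; rewrite n_gt0 le_nB.
have le_sum : (\sum_i #|` t i| <=
    \sum_i (#|` B i| - #|` n i|) + \sum_i #|` C i|)%N.
  by rewrite -big_split; apply: leq_sum => i _.
move: leN leE le_prod le_sum; lia.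
Qed.

Lemma is_clique_number_product :
  is_clique_number (@zero_prod_graph (ring_product R))
    (\prod_i #|` B i| + \sum_i #|` C i|)%N.
Proof.
split; last first.
  move=> S cS; rewrite -card_sq_parts split_clique_product_leq //.
  exact: clique_split.
have [cU _ cardU] := split_clique_union split_clique_product.
exists (fset_pi B `|` fset_axes C) => //.
rewrite cardU card_fset_pi card_fset_axes // => i.
have [[_ C2 _ _] _] := optBC i.
by apply/negP=> /C2; rewrite expr0n eqxx.
Qed.

End ProductRing.

Theorem theorem2p1 (n : nat) (hn : (1 <= n)%N) (R : 'I_n -> comPzRingType)
    (hchi : forall i : 'I_n, chi (R i) <> None)
    (A : forall i : 'I_n, {fset (R i)})
    (hA : forall i : 'I_n, optimal_maximum_clique (A i)) :
  omega (ring_product R) =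
    (\prod_(i < n) (omega (R i) - #|` sq_nonzero_part (A i)|%fset)
     + \sum_(i < n) (omega (R i) - #|` sq_zero_part (A i)|%fset))%N.
Proof.
have optA i : optimal_split (sq_zero_part (A i)) (sq_nonzero_part (A i)).
  have [w w_num] := finite_chromatic_clique_number (hchi i).
  exact: optimal_cliqueP w_num (hA i).
have omegaE i : omega (R i) =
    (#|` sq_zero_part (A i)| + #|` sq_nonzero_part (A i)|)%N.
  by rewrite card_sq_parts; have [[_ ->] _] := hA i.
rewrite [LHS](clique_number_eq (is_clique_number_product optA)).
by congr (_ + _)%N; apply: eq_bigr => i _; rewrite omegaE ?addnK ?addKn.
Qed.
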